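(* Every satisfiable $\mathrm{LRP}$ formula is satisfied by a finite graph.
   Context: A vocabulary is $\tau=\langle C,U,F\rangle$, where $C$ is a finite set of constant symbols, $U$ a set of unary relation symbols and $F$ a finite set of binary relation symbols (edge labels). A graph (interpretation) over $\tau$ is $G=\langle V,E,C^G,U^G\rangle$ with $V$ a set of nodes, $E(f)\subseteq V\times V$ for $f\in F$, $C^G(c)\in V$ for $c\in C$, and $U^G(u)\subseteq V$ for $u\in U$. Terms are variables or constants; atomic formulas are $t=t'$, $u(t)$ and $t\xrightarrow{f}t'$ (meaning $(t,t')\in E(f)$); quantifier-free formulas are Boolean combinations of atomic formulas. Routing expressions are given by the grammar $R::=\emptyset\mid\epsilon\mid \xrightarrow{f}\mid \xleftarrow{f}\mid u\mid\neg u\mid c\mid \neg c\mid R_1.R_2\mid R_1|R_2\mid R^*$ ($f\in F,u\in U,c\in C$), denoting a language $L(R)$ of words over the letters $\xrightarrow{f},\xleftarrow{f},u,\neg u,c,\neg c$. A path labelled by a word $w$ from node $a$ to node $b$ is defined by: $\epsilon$: $a=b$; $\xrightarrow{f}$: $(a,b)\in E(f)$; $\xleftarrow{f}$: $(b,a)\in E(f)$; $u$: $a=b\in U^G(u)$; $\neg u$: $a=b\notin U^G(u)$; $c$: $a=b=C^G(c)$; $\neg c$: $a=b\neq C^G(c)$; and a word $w_1w_2$ labels a path from $a$ to $b$ iff there is a node $d$ with a $w_1$-path from $a$ to $d$ and a $w_2$-path from $d$ to $b$. An $R$-path is a path labelled by some word of $L(R)$. A neighborhood formula $N(v_0,\dots,v_n)$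 is a conjunction of edge atoms $v_i\xrightarrow{f}v_j$. A reachability constraint, written $[c,R]p$, is a closed formula $\forall v_0,\dots,v_n.\ R(c,v_0)\Rightarrow(N(v_0,\dots,v_n)\Rightarrow\psi(v_0,\dots,v_n))$ where $c\in C$, $R$ is a routing expression, $N$ is a neighborhood formula, $\psi$ is quantifier-free, the free variables of $N$ are among $v_0,\dots,v_n$ and those of $\psi$ are among $FV(N)\cup\{v_0\}$; $p(v_0):=N\Rightarrow\psi$ is its pattern. A graph $G$ satisfies it iff for every node $a$ reachable by an $R$-path from $C^G(c)$ and every assignment of nodes to $v_0,\dots,v_n$ with $v_0\mapsto a$, the assignment satisfies $N\Rightarrow\psi$. An $\mathrm{LRP}$ formula is a Boolean combination of reachability constraints, with the usual semantics of Boolean connectives. *)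

(* Defs.v *)
From mathcomp Require Import all_boot.
From mathcomp Require Import classical_sets functions cardinality.

Set Implicit Arguments.
Unset Strict Implicit.
Unset Printing Implicit Defensive.

Local Open Scope classical_set_scope.

Record vocabulary := Vocabulary {
  vconst : finType;
  vunary : Type;
  vedge : finType
}.

(* The node set may be empty (only possible when there are no constants). *)
Record graph (tau : vocabulary) := Graph {
  node : Type;
  gedge : vedge tau -> set (node * node);
  gconst : vconst tau -> node;
  gunary : vunary tau -> set node
}.
Arguments gedge {tau} G f : rename.
Arguments gconst {tau} G c : rename.
Arguments gunary {tau} G u : rename.

Definition finite_graph (tau : vocabulary) (G : graph tau) : Prop :=
  finite_set [set: node G].

Inductive boolcomb (A : Type) : Type :=
| BTrue
| BFalse
| BAtom of A
| BNot of boolcomb A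
| BAnd of boolcomb A & boolcomb A
| BOr of boolcomb A & boolcomb A.
Arguments BTrue {A}.
Arguments BFalse {A}.

Fixpoint bholds (A : Type) (I : A -> Prop) (p : boolcomb A) : Prop :=
  match p with
  | BTrue => True
  | BFalse => False
  | BAtom a => I a
  | BNot q => ~ bholds I q
  | BAnd q r => bholds I q /\ bholds I r
  | BOr q r => bholds I q \/ bholds I r
  end.

Fixpoint batoms (A : Type) (p : boolcomb A) : seq A :=
  match p with
  | BTrue | BFalse => [::]
  | BAtom a => [:: a]
  | BNot q => batoms q
  | BAnd q r | BOr q r => batoms q ++ batoms r
  end.

Inductive letter (tau : vocabulary) : Type :=
| LFwd of vedge tau
| LBwd of vedge tau
| LUnary of vunary tau
| LNotUnary of vunary tau
| LConst of vconst tau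
| LNotConst of vconst tau.

Definition word (tau : vocabulary) := seq (letter tau).

Inductive routing (tau : vocabulary) : Type :=
| REmpty
| REps
| RLetter of letter tau
| RCat of routing tau & routing tau
| RAlt of routing tau & routing tau
| RStar of routing tau.
Arguments REmpty {tau}.
Arguments REps {tau}.

Definition lang_cat (tau : vocabulary) (L1 L2 : set (word tau)) :
    set (word tau) :=
  [set w | exists w1 w2, [/\ L1 w1, L2 w2 & w = w1 ++ w2]].

Inductive lang_star (tau : vocabulary) (L : set (word tau)) :
    word tau -> Prop :=
| lang_star_nil : lang_star L [::]
| lang_star_cat w1 w2 : L w1 -> lang_star L w2 -> lang_star L (w1 ++ w2).

Fixpoint lang (tau : vocabulary) (R : routing tau) : set (word tau) :=
  match R with
  | REmpty => set0
  | REps => [set [::]]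
  | RLetter l => [set [:: l]]
  | RCat R1 R2 => lang_cat (lang R1) (lang R2)
  | RAlt R1 R2 => lang R1 `|` lang R2
  | RStar R1 => lang_star (lang R1)
  end.

Definition letter_path (tau : vocabulary) (G : graph tau) (l : letter tau)
    (a b : node G) : Prop :=
  match l with
  | LFwd f => gedge G f (a, b)
  | LBwd f => gedge G f (b, a)
  | LUnary u => a = b /\ gunary G u b
  | LNotUnary u => a = b /\ ~ gunary G u b
  | LConst c => a = b /\ b = gconst G c
  | LNotConst c => a = b /\ b <> gconst G c
  end.

Fixpoint word_path (tau : vocabulary) (G : graph tau) (w : word tau)
    (a b : node G) : Prop :=
  match w with
  | [::] => a = b
  | l :: w' => exists d, letter_path l a d /\ word_path w' d b
  end.

(* [word_path] decomposes one letter at a time; the next two facts recover the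
   clause for single letters and the clause for arbitrary concatenations. *)
Lemma word_path1 (tau : vocabulary) (G : graph tau) (l : letter tau)
    (a b : node G) :
  word_path [:: l] a b <-> letter_path l a b.
Proof.
split=> [[d [ld <-]] //|lb].
by exists b; split.
Qed.

Lemma word_path_cat (tau : vocabulary) (G : graph tau) (w1 w2 : word tau)
    (a b : node G) :
  word_path (w1 ++ w2) a b <->
  exists d, word_path w1 a d /\ word_path w2 d b.
Proof.
elim: w1 a => [|l w1 IH] a /=.
  by split=> [wb|[d [-> //]]]; exists a.
split=> [[e [le /IH [d [w1d w2b]]]]|[d [[e [le w1d]] w2b]]].
  by exists d; split=> //; exists e.
by exists e; split=> //; apply/IH; exists d.
Qed.

Definition routing_path (tau : vocabulary) (G : graph tau) (R : routing tau)
    (a b : node G) : Prop :=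
  exists2 w, lang R w & word_path w a b.

Inductive term (tau : vocabulary) (X : Type) : Type :=
| TVar of X
| TConst of vconst tau.

Inductive atom (tau : vocabulary) (X : Type) : Type :=
| AEq of term tau X & term tau X
| AUnary of vunary tau & term tau X
| AEdge of vedge tau & term tau X & term tau X.

Definition qfform (tau : vocabulary) (X : Type) := boolcomb (atom tau X).

Definition term_fv (tau : vocabulary) (X : Type) (t : term tau X) : seq X :=
  match t with TVar x => [:: x] | TConst _ => [::] end.

Definition atom_fv (tau : vocabulary) (X : Type) (p : atom tau X) : seq X :=
  match p with
  | AEq t t' => term_fv t ++ term_fv t'
  | AUnary _ t => term_fv t
  | AEdge _ t t' => term_fv t ++ term_fv t'
  end.

Definition qf_fv (tau : vocabulary) (X : Type) (psi : qfform tau X) : seq X :=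
  flatten [seq atom_fv p | p <- batoms psi].

Definition term_val (tau : vocabulary) (X : Type) (G : graph tau)
    (s : X -> node G) (t : term tau X) : node G :=
  match t with TVar x => s x | TConst c => gconst G c end.

Definition atom_sat (tau : vocabulary) (X : Type) (G : graph tau)
    (s : X -> node G) (p : atom tau X) : Prop :=
  match p with
  | AEq t t' => term_val s t = term_val s t'
  | AUnary u t => gunary G u (term_val s t)
  | AEdge f t t' => gedge G f (term_val s t, term_val s t')
  end.

Definition qf_sat (tau : vocabulary) (X : Type) (G : graph tau)
    (s : X -> node G) (psi : qfform tau X) : Prop :=
  bholds (atom_sat s) psi.

(* [(x, f, y)] stands for the edge atom [x -f-> y]; the list is read as a
   conjunction, the empty one being true. *)
Definition neighborhood (tau : vocabulary) (X : Type) :=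
  seq (X * vedge tau * X).

Definition neighborhood_fv (tau : vocabulary) (X : Type)
    (N : neighborhood tau X) : seq X :=
  flatten [seq [:: e.1.1; e.2] | e <- N].

Definition neighborhood_sat (tau : vocabulary) (X : eqType) (G : graph tau)
    (s : X -> node G) (N : neighborhood tau X) : Prop :=
  forall x f y, (x, f, y) \in N -> gedge G f (s x, s y).

(* The variables [v_0, ..., v_n] are the elements of ['I_n.+1], with
   [v_0 = ord0]. *)
Record constraint (tau : vocabulary) := Constraint {
  rc_n : nat;
  rc_const : vconst tau;
  rc_routing : routing tau;
  rc_nbh : neighborhood tau 'I_rc_n.+1;
  rc_concl : qfform tau 'I_rc_n.+1;
  rc_fv : {subset qf_fv rc_concl <= ord0 :: neighborhood_fv rc_nbh}
}.

Definition constraint_sat (tau : vocabulary) (G : graph tau)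
    (k : constraint tau) : Prop :=
  forall a : node G,
    routing_path (rc_routing k) (gconst G (rc_const k)) a ->
  forall s : 'I_(rc_n k).+1 -> node G, s ord0 = a ->
    neighborhood_sat s (rc_nbh k) -> qf_sat s (rc_concl k).

Definition lrp (tau : vocabulary) := boolcomb (constraint tau).

Definition lrp_sat (tau : vocabulary) (G : graph tau) (phi : lrp tau) : Prop :=
  bholds (constraint_sat G) phi.

Definition lrp_satisfiable (tau : vocabulary) (phi : lrp tau) : Prop :=
  exists G : graph tau, lrp_sat G phi.

(* Main.v *)
From mathcomp Require Import all_boot.
From mathcomp Require Import boolp classical_sets cardinality.
Require Import Defs.

Set Implicit Arguments.
Unset Strict Implicit.
Unset Printing Implicit Defensive.

Local Open Scope classical_set_scope.

(** A reachability constraint is preserved under induced subgraphs containing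
    the constants: paths and neighborhoods of the subgraph are paths and
    neighborhoods of the whole graph, and quantifier-free formulas have the same
    value in both.  A violated constraint stays violated in every induced
    subgraph that contains the finitely many nodes of one violating path and
    assignment.  Hence the subgraph induced on the constants and on one such
    finite set of witnesses per violated constraint of the formula gives every
    constraint of the formula its original truth value. *)

Section Induced.

Variables (tau : vocabulary) (G : graph tau).

Definition induced (A : set (node G)) (cA : forall c, A (gconst G c)) :
    graph tau :=
  @Graph tau (set_type A)
    (fun f => [set e | gedge G f (\val e.1, \val e.2)])
    (fun c => SigSub (mem_set (cA c)))
    (fun u => [set x | gunary G u (\val x)]).

Section Agreement.

Variables (A : set (node G)) (cA : forall c, A (gconst G c)).

Lemma induced_eq (a b : node (induced cA)) :
  (a = b) = (\val (a : set_type A) = \val (b : set_type A)).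
Proof. by apply/propext; split=> [->//|/val_inj]. Qed.

Lemma induced_letter_path l (a b : node (induced cA)) :
  letter_path l a b <->
  letter_path l (\val (a : set_type A)) (\val (b : set_type A)).
Proof. by case: l => x //=; rewrite !induced_eq. Qed.

(** The converse can fail: a path of [G] between nodes of [A] may pass through nodes outside [A]. *)
Lemma induced_word_path w (a b : node (induced cA)) :
  word_path w a b ->
  word_path w (\val (a : set_type A)) (\val (b : set_type A)).
Proof.
elim: w a => [|l w IH] a /=; first by move=> ->.
by move=> [d [/induced_letter_path ld /IH wb]]; exists (\val (d : set_type A)).
Qed.

Lemma induced_term_val X (s : X -> node (induced cA)) t :
  \val (term_val s t : set_type A)
  = term_val (fun x => \val (s x : set_type A)) t.
Proof. by case: t. Qed.

Lemma induced_qf_sat X (s : X -> node (induced cA)) psi :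
  qf_sat s psi <-> qf_sat (fun x => \val (s x : set_type A)) psi.
Proof.
rewrite /qf_sat; elim: psi => //= [p|||]; [|tauto..].
by case: p => [t t'|u t|f t t'] /=; rewrite ?induced_eq !induced_term_val.
Qed.

Lemma induced_constraint_sat k :
  constraint_sat G k -> constraint_sat (induced cA) k.
Proof.
move=> Gk a [w Rw wa] s s0 Ns; apply/induced_qf_sat.
apply: (Gk (\val (a : set_type A))) => //; last by rewrite s0.
by exists w => //; apply: induced_word_path wa.
Qed.

End Agreement.

(** A single path visits finitely many nodes. Allowing every [A] above [W] lets supports be enlarged
    and merged by union. *)
Lemma word_path_support w (a b : node G) : word_path w a b ->
  exists2 W : set (node G), finite_set W &
    forall A (cA : forall c, A (gconst G c)), W `<=` A ->
    forall a' b' : node (induced cA),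
      \val (a' : set_type A) = a -> \val (b' : set_type A) = b ->
      word_path w a' b'.
Proof.
elim: w a => [|l w IH] a /=.
  move=> ->; exists set0 => // A cA _ a' b' a'b b'b.
  exact: val_inj (etrans a'b (esym b'b)).
move=> [d [ld /IH [W finW WP]]].
(* The start node is supplied by [a'], so only nodes visited after it are collected. *)
exists (d |` W); first by rewrite finite_setU; split.
move=> A cA WA a' b' a'a b'b.
have Ad : A d by apply: WA; left.
exists (SigSub (mem_set Ad) : set_type A); split.
  by apply/induced_letter_path; rewrite -a'a in ld.
by apply: WP => // x Wx; apply: WA; right.
Qed.

Lemma constraint_support k :
  exists2 W : set (node G), finite_set W &
    forall A (cA : forall c, A (gconst G c)), W `<=` A ->
    constraint_sat (induced cA) k <-> constraint_sat G k.
Proof.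
have [Gk|nGk] := pselect (constraint_sat G k).
  by exists set0 => // A cA _; split=> // _; apply: induced_constraint_sat.
have [a [[w Rw wa] [s [s0 Ns npsi]]]] : exists a,
    routing_path (rc_routing k) (gconst G (rc_const k)) a /\
    exists s : 'I_(rc_n k).+1 -> node G,
      [/\ s ord0 = a, neighborhood_sat s (rc_nbh k) & ~ qf_sat s (rc_concl k)].
  apply: contrapT => none; apply: nGk => a Ra s s0 Ns.
  by apply: contrapT => npsi; apply: none; exists a; split=> //; exists s.
have [W finW WP] := word_path_support wa.
(* [W] preserves the violating path and [range s] the violating assignment, which has finitely many
   variables. *)
exists (W `|` range s).
  by rewrite finite_setU; split=> //; apply: finite_image; apply: finite_finset.
move=> A cA WA; split=> // Ak; case: npsi.
have As i : A (s i) by apply: WA; right; exists i.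
pose s' i : node (induced cA) := SigSub (mem_set (As i)) : set_type A.
suff /induced_qf_sat : qf_sat s' (rc_concl k) by [].
apply: (Ak (s' ord0)) => //.
by exists w => //; apply: WP => // x Wx; apply: WA; left.
Qed.

(** An equivalence, not just an implication, is what carries the induction through negation. *)
Lemma lrp_support (phi : lrp tau) :
  exists2 W : set (node G), finite_set W &
    forall A (cA : forall c, A (gconst G c)), W `<=` A ->
    lrp_sat (induced cA) phi <-> lrp_sat G phi.
Proof.
elim: phi => [||k|q [W finW IH]|q [W1 fin1 H1] r [W2 fin2 H2]
  |q [W1 fin1 H1] r [W2 fin2 H2]].
- by exists set0.
- by exists set0.
- exact: constraint_support.
- by exists W => // A cA /(IH A cA); rewrite /lrp_sat /=; tauto.
- exists (W1 `|` W2); first by rewrite finite_setU.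
  move=> A cA; rewrite subUset => -[/(H1 A cA) + /(H2 A cA)].
  by rewrite /lrp_sat /=; tauto.
- exists (W1 `|` W2); first by rewrite finite_setU.
  move=> A cA; rewrite subUset => -[/(H1 A cA) + /(H2 A cA)].
  by rewrite /lrp_sat /=; tauto.
Qed.

End Induced.

Theorem theorem1 (tau : vocabulary) (phi : lrp tau) :
  lrp_satisfiable phi ->
  exists G : graph tau, finite_graph G /\ lrp_sat G phi.
Proof.
move=> [G Gphi]; have [W finW WP] := lrp_support G phi.
(* The constants must be interpreted inside [A]; there are finitely many of them, so [A] stays
   finite. *)
pose A := W `|` range (gconst G).
have cA c : A (gconst G c) by right; exists c.
exists (induced cA); split; last by apply/WP => // x; left.
rewrite /finite_graph (eq_finite_set (card_setT A)) finite_setU; split=> //.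
by apply: finite_image; apply: finite_finset.
Qed.
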